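(* Let $F$ be a field, let $n\ge 1$, let $A = Fe_1\oplus\ldots\oplus Fe_n$ be the direct sum of $n$ copies of $F$, and let $\lambda\in F$, $\lambda\ne 0$. There is a bijection between the set of Rota–Baxter operators of weight $\lambda$ on $A$ and (a) the set of 2-colored transitive subtree acyclic digraphs on $n$ (labeled) vertices; (b) the set of labeled rooted trees on $n+1$ vertices with 2-colored non-root vertices.
   Context: $A = Fe_1\oplus\ldots\oplus Fe_n$ is the $F$-algebra $F^n$ with $e_ie_j=\delta_{ij}e_i$. A Rota–Baxter operator of weight $\lambda$ on $A$ is an $F$-linear map $R\colon A\to A$ with $R(x)R(y) = R(R(x)y + xR(y) + \lambda xy)$ for all $x,y\in A$. Digraphs are simple digraphs on the vertex set $\{1,\ldots,n\}$ (no loops, no multiple edges). A subtree acyclic digraph (equivalently, a moral directed acyclic graph) is a digraph without directed cycles which contains no induced subgraph on three distinct vertices $i,k,l$ whose edge set is exactly $\{(i,l),(k,l)\}$. A digraph with edge set $E$ is transitive if $(i,k)\in E$ and $(k,l)\in E$ imply $(i,l)\in E$. ''2-colored'' means that each vertex (in (b), each non-root vertex) is assigned one of two fixed colors, arbitrarily (the coloring need not be proper). The labeled rooted trees on $n+1$ vertices are the trees on the vertex set $\{0,1,\ldots,n\}$ with root the fixed vertex $0$. *)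

(* Defs.v *)
From mathcomp Require Import all_boot all_algebra.
From mathcomp Require Import classical_sets functions.

Set Implicit Arguments.
Unset Strict Implicit.
Unset Printing Implicit Defensive.

Import GRing.Theory.

Local Open Scope ring_scope.
Local Open Scope classical_set_scope.

Section RotaBaxter.

Variables (F : fieldType) (n : nat).

(* The algebra F^n with componentwise operations; [F^o] is F as a vector space
   over itself, and lets the library infer the scaling by F. *)
Local Notation A := {ffun 'I_n -> F^o}.

Definition rota_baxter (lambda : F) (R : 'End(A)) : Prop :=
  forall x y : A, R x * R y = R (R x * y + x * R y + lambda *: (x * y)).

End RotaBaxter.

Section Digraphs.

(* A digraph on [V] is given by its set of edges [(i, j)]. Pairs being in a set,
   there are no multiple edges. *)
Variable V : finType.
Implicit Types (G : {set V * V}) (W : {set V}).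

Definition edge_rel G : rel V := fun i j => (i, j) \in G.

Definition simple_digraph G : Prop := forall i : V, (i, i) \notin G.

Definition directed_acyclic G : Prop :=
  forall c : seq V, c <> [::] -> ~ ucycle (edge_rel G) c.

Definition induced G W : {set V * V} := G :&: finset.setX W W.

Definition subtree_acyclic G : Prop :=
  [/\ simple_digraph G, directed_acyclic G &
      forall i k l : V, uniq [:: i; k; l] ->
        induced G [set i; k; l]%SET <> [set (i, l); (k, l)]%SET].

Definition transitive_digraph G : Prop := transitive (edge_rel G).

(* The two colors are the booleans. *)
Definition colored_transitive_subtree_acyclic :
    set ({set V * V} * {ffun V -> bool}) :=
  [set Gc | subtree_acyclic Gc.1 /\ transitive_digraph Gc.1].

End Digraphs.

Arguments colored_transitive_subtree_acyclic : clear implicits.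

Section Trees.

(* A simple graph on [V] is given by its set of edges, which are unordered pairs
   of distinct vertices. *)
Variable V : finType.
Implicit Types T : {set {set V}}.

Definition adjacent T : rel V := fun i j => [set i; j]%SET \in T.

Definition simple_graph T : Prop := forall e : {set V}, e \in T -> #|e| = 2%N.

Definition connected_graph T : Prop := forall i j : V, connect (adjacent T) i j.

(* A sequence [:: i; j] along an edge is a [ucycle] without being a cycle of
   the graph, whence the bound on the length. *)
Definition acyclic_graph T : Prop :=
  forall c : seq V, (2 < size c)%N -> ~ ucycle (adjacent T) c.

Definition tree T : Prop :=
  [/\ simple_graph T, connected_graph T & acyclic_graph T].

(* Trees with the prescribed root [r], each vertex other than [r] being colored
   with a boolean. *)
Definition rooted_trees_colored (r : V) :
    set ({set {set V}} * {ffun {v : V | v != r} -> bool}) :=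
  [set Tc | tree Tc.1].

End Trees.

Arguments rooted_trees_colored : clear implicits.

(* Main.v *)
(* On the idempotent basis, write R(e_i) = sum_k r_ik e_k. The Rota-Baxter
   identity on basis vectors forces r_ii to be 0 or -lambda, which is the color
   of i, and r_ik to be 0 or 2 r_ii + lambda = +-lambda for i != k; so R is
   determined by the colors and the digraph { (i, k) | i != k, r_ik != 0 }.
   Signs factor out of the remaining identities, which become: i and j both
   precede k iff i -> j -> k or j -> i -> k. This says that the digraph is a
   strict order in which the predecessors of every vertex form a chain.
   Both such orders and the trees rooted at r are described by parent maps,
   i.e. self-maps fixing r all of whose orbits reach r: i precedes k iff i is a
   proper ancestor of k, and the edges of the tree join each vertex to its
   parent. *)
From HB Require Import structures.
Require Import Defs.
From mathcomp Require Import all_boot all_algebra.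
From mathcomp Require Import ring.
From mathcomp Require Import classical_sets functions.

Set Implicit Arguments.
Unset Strict Implicit.
Unset Printing Implicit Defensive.

Import GRing.Theory.

Local Open Scope ring_scope.
Local Open Scope classical_set_scope.

(** * Spanning subgraphs of acyclic graphs *)

Section Tree.
Variable V : finType.
Implicit Types (T : {set {set V}}) (u v w : V).

Lemma adjacent_sym T : symmetric (adjacent T).
Proof. by move=> u v; rewrite /adjacent finset.setUC. Qed.

(** An edge of [T] outside [T'] would close a simple path of [T'] between its ends into a cycle of
    [T]. *)
Lemma connected_acyclic_eq T T' :
  T' \subset T -> simple_graph T -> acyclic_graph T -> connected_graph T' ->
  T' = T.
Proof.
move=> /fintype.subsetP sTT' simT acT conT'; apply/eqP; rewrite finset.eqEsubset.
apply/andP; split; apply/fintype.subsetP => // e eT.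
have /eqP/cards2P[u [w [uw eE]]] := simT e eT; rewrite eE in eT *.
have /connectP[s us ws] := conT' u w.
case/shortenP: us ws => -[|x [|y s']] us uniq_s _ ws.
- by rewrite ws eqxx in uw.
- by move: us; rewrite /= andbT ws.
- case: (acT [:: u, x, y & s']) => //; rewrite /ucycle uniq_s andbT.
  rewrite /cycle -cats1 cat_path; apply/andP; split.
    exact: (sub_path (fun a b => sTT' [set a; b]%SET) us).
  by rewrite -ws /= andbT adjacent_sym.
Qed.

End Tree.

(** * Parent maps and their trees *)

Section ParentMap.
Variables (V : finType) (r : V).
Implicit Types (p q : {ffun V -> V}) (u v w : V).

Definition parent_map p : Prop := p r = r /\ forall v, fconnect p v r.

Definition tree_of p : {set {set V}} :=
  [set [set v; p v]%SET | v : V & v != r]%SET.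

Let depth p v := findex p v r.

Section Depth.
Variable p : {ffun V -> V}.
Hypothesis p_map : parent_map p.

Lemma depth_parent v : v != r -> depth p v = (depth p (p v)).+1.
Proof.
move=> vr; rewrite /depth fconnect_findex 1?eq_sym //.
exact: p_map.2.
Qed.

Lemma parent_neq v : v != r -> p v != v.
Proof.
move=> vr; apply/eqP => pv; have := depth_parent vr; rewrite pv => /eqP.
by rewrite -[X in X == _]addn0 -addn1 eqn_add2l.
Qed.

Lemma depth_connect u v : fconnect p u v -> (depth p v <= depth p u)%N.
Proof.
move=> /iter_findex <-; elim: (findex p u v) => //= m IHm.
apply: leq_trans IHm; set x := iter m p u.
have [->|xr] := eqVneq x r; first by rewrite p_map.1.
by rewrite (depth_parent xr).
Qed.

(** Depth never increases along an orbit and drops at the step from [u], so no orbit leaving [u]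
    returns to it. *)
Lemma parent_connect u v :
  u != r -> fconnect p (p u) v -> ~~ fconnect p v u.
Proof.
move=> ur /depth_connect le_v; apply/negP => /depth_connect.
by rewrite (depth_parent ur) ltnNge le_v.
Qed.

Lemma adjacent_tree_of u w :
  adjacent (tree_of p) u w =
    ((u != r) && (p u == w)) || ((w != r) && (p w == u)).
Proof.
apply/imsetP/orP => [[v]|].
  rewrite inE => vr /finset.setP E.
  have : u \in [set v; p v]%SET by rewrite -E set21.
  have : w \in [set v; p v]%SET by rewrite -E set22.
  have : p v \in [set u; w]%SET by rewrite E set22.
  have : v \in [set u; w]%SET by rewrite E set21.
  rewrite !inE => /orP[]/eqP<- /orP[]/eqP Ev.
  - by have := parent_neq vr; rewrite Ev eqxx.
  - by left; rewrite vr Ev eqxx.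
  - by right; rewrite vr Ev eqxx.
  - by have := parent_neq vr; rewrite Ev eqxx.
case=> /andP[vr /eqP <-]; [exists u|exists w]; rewrite ?inE //.
by rewrite finset.setUC.
Qed.

Lemma tree_of_tree : tree (tree_of p).
Proof.
split.
- move=> e /imsetP[v]; rewrite inE => vr ->.
  by rewrite cards2 eq_sym parent_neq.
- have root v : connect (adjacent (tree_of p)) v r.
    have /connectP[s vs ->] := p_map.2 v.
    elim: s v vs => [|y s IHs] v /=; first by rewrite connect0.
    case/andP=> /eqP <- vs; apply: connect_trans (IHs _ vs).
    have [->|vr] := eqVneq v r; first by rewrite p_map.1 connect0.
    by apply: connect1; rewrite adjacent_tree_of vr eqxx.
  move=> i j; apply: connect_trans (root i) _.
  by rewrite sym_connect_sym //; apply: adjacent_sym.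
- move=> c c2 /andP[cyc_c uniq_c].
  (* Both neighbours in the cycle of a deepest vertex would be its parent. *)
  have [x0 x0c] : exists x, x \in c.
    by case: c c2 {cyc_c uniq_c} => // x; exists x; rewrite inE eqxx.
  case: (@arg_maxnP _ x0 [in c] (depth p) x0c) => v vc max_v.
  have [i s rot_c] := rot_to vc.
  have sub_s : {subset s <= c}.
    by move=> x xs; rewrite -(mem_rot i) rot_c inE xs orbT.
  have up x : x \in c -> adjacent (tree_of p) v x -> p v = x.
    rewrite adjacent_tree_of => xc /orP[/andP[_ /eqP//]|/andP[xr /eqP pxv]].
    by have := max_v x xc; rewrite /= (depth_parent xr) pxv /geq /= ltnn.
  move: c2 cyc_c uniq_c; rewrite -(size_rot i) -(rot_cycle i) -(rot_uniq i) rot_c.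
  (* With [v] rotated to the front, its neighbours are [a] and the last vertex, which differ as the
     cycle has at least three vertices. *)
  case: s sub_s {rot_c} => [|a [|b s]] sub_s //= _ /andP[va /andP[ab]].
  rewrite rcons_path => /andP[bs]; rewrite adjacent_sym => vlast.
  have Ea : p v = a by apply: up va; apply: sub_s; rewrite inE eqxx.
  have El : p v = last b s.
    by apply: up vlast; apply: sub_s; rewrite inE mem_last orbT.
  by case/and3P => _; rewrite -Ea El mem_last.
Qed.

End Depth.

(** Induction on depth: the edge from [v] to [p v] lies in [tree_of q], so [q v = p v] or
    [q (p v) = v]. In the second case the induction hypothesis yields [p (p v) = v], against the
    depth. *)
Lemma tree_of_inj p q :
  parent_map p -> parent_map q -> tree_of p = tree_of q -> p = q.
Proof.
move=> pP qP Epq; apply/ffunP => v.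
have [m] := ubnP (depth p v); elim: m v => // m IHm v lt_v.
have [->|vr] := eqVneq v r; first by rewrite pP.1 qP.1.
have : adjacent (tree_of p) v (p v) by rewrite adjacent_tree_of // vr eqxx.
rewrite Epq adjacent_tree_of // => /orP[/andP[_ /eqP->//]|/andP[pvr /eqP qpv]].
have ppv : p (p v) = v.
  by rewrite IHm // -ltnS -(depth_parent pP vr).
have := parent_connect pP vr (connect0 _ (p v)).
by rewrite -{2}ppv fconnect1.
Qed.

(** Breadth-first search: each vertex takes as parent a neighbour at smaller distance from [r]. *)
Lemma connected_spanned T :
  connected_graph T ->
  exists2 p, parent_map p & tree_of p \subset T.
Proof.
move=> conT.
pose reach v k :=
  [exists t : k.-tuple V, path (adjacent T) v t && (last v t == r)].
have ex_reach v : exists k, reach v k.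
  have /connectP[s vs rs] := conT v r.
  exists (size s); apply/existsP; exists (in_tuple s).
  by rewrite /= vs -rs eqxx.
pose dist v := ex_minn (ex_reach v).
have dist_step v : v != r -> exists u, adjacent T v u && (dist u < dist v)%N.
  rewrite /dist; case: ex_minnP => -[|k] /existsP[[[|u s] //= sz]].
    by move=> /eqP->; rewrite eqxx.
  move=> /andP[/andP[vu us] /eqP rs] _ _; exists u; rewrite vu /= ltnS.
  case: ex_minnP => k' _; apply; apply/existsP.
  by exists (@Tuple _ _ s sz); rewrite /= us rs eqxx.
(* By [dist_step] the default of [odflt] is never reached away from the root. *)
pose p := [ffun v => if v == r then r else
             odflt r [pick u | adjacent T v u && (dist u < dist v)%N]].
have pP v : v != r -> adjacent T v (p v) && (dist (p v) < dist v)%N.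
  move=> vr; rewrite ffunE (negPf vr); case: pickP => // none.
  by have [u] := dist_step v vr; rewrite none.
exists p.
  split=> [|v]; first by rewrite ffunE eqxx.
  have [m] := ubnP (dist v); elim: m v => // m IHm v lt_v.
  have [->|vr] := eqVneq v r; first exact: connect0.
  have /andP[_ lt_p] := pP v vr.
  apply: connect_trans (fconnect1 _ _) (IHm _ _).
  exact: leq_trans lt_p lt_v.
apply/fintype.subsetP => e /imsetP[v]; rewrite inE => vr ->.
by case/andP: (pP v vr).
Qed.

(** A connected graph contains the tree of a parent map; if it is itself a tree,
    [connected_acyclic_eq] makes the two equal. *)
Lemma tree_of_bij (C : Type) :
  set_bij [set pc : {ffun V -> V} * C | parent_map pc.1] [set Tc | tree Tc.1]
          (fun pc => (tree_of pc.1, pc.2)).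
Proof.
split.
- by move=> [p c] /= /tree_of_tree.
- move=> [p c] [q d]; rewrite !inE /= => pP qP [Epq ->].
  by rewrite (tree_of_inj pP qP Epq).
- move=> [T c] /= [simT conT acT]; have [p pP pT] := connected_spanned conT.
  exists (p, c) => //=; congr (_, _); apply: connected_acyclic_eq pT _ _ _ => //.
  by have [_] := tree_of_tree pP.
Qed.

End ParentMap.

(** * Transitive subtree acyclic digraphs as strict orders *)

Section ForestOrder.
Variable V : finType.
Implicit Types G : {set V * V}.

Definition forest_order G : Prop :=
  [/\ irreflexive (edge_rel G), transitive (edge_rel G) &
      forall i k l : V, i != k -> (i, l) \in G -> (k, l) \in G ->
        ((i, k) \in G) || ((k, i) \in G)].

(** Edges from [i] and [k] into [l] are never reversed, so unless [i] and [k] are joined the three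
    vertices induce the forbidden subgraph. Conversely, transitivity would shrink a directed cycle
    to a loop. *)
Lemma forest_orderP G :
  subtree_acyclic G /\ transitive_digraph G <-> forest_order G.
Proof.
split=> [[[simG _ mor] trG] | [irr trG chain]].
  have irr : irreflexive (edge_rel G) by move=> i; apply/negbTE/simG.
  split=> // i k l ik il kl.
  have neq j m : (j, m) \in G -> j != m.
    by move=> jm; apply: contraTneq jm => ->; apply: simG.
  have asym j m : (j, m) \in G -> (m, j) \in G = false.
    move=> jm; apply/negP => mj; have := trG _ _ _ jm mj.
    by rewrite irr.
  have uniq_ikl : uniq [:: i; k; l] by rewrite /= !inE negb_or ik !neq.
  apply: contra_notT (mor i k l uniq_ikl).
  rewrite negb_or => /andP[/negPf nik /negPf nki].
  apply/finset.setP => -[a b]; rewrite !inE /= !xpair_eqE.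
  apply/idP/idP.
    case/and3P => ab a3 b3; move: ab.
    case/orP: a3 => [/orP[]|] /eqP ->; case/orP: b3 => [/orP[]|] /eqP ->;
    by rewrite ?nik ?nki ?(asym _ _ il) ?(asym _ _ kl) ?(negPf (simG _)) ?eqxx
      ?orbT.
  by case/orP => /andP[/eqP-> /eqP->]; rewrite ?il ?kl !eqxx ?orbT.
have simG : simple_digraph G by move=> i; apply/negbT/irr.
split=> //; split=> //.
  move=> [|x s] // _ /andP[/= cyc _].
  have /allP/(_ x) := order_path_min trG cyc.
  by rewrite mem_rcons inE eqxx irr => /(_ isT).
move=> i k l; rewrite /= !inE negb_or => /and3P[/andP[ik il] kl _] /finset.setP E.
have := E (i, l); have := E (k, l).
rewrite !inE !eqxx !orbT /= !andbT => klG ilG.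
have := E (i, k); have := E (k, i).
rewrite !inE !eqxx !orbT /= !andbT !xpair_eqE.
rewrite (negPf il) (negPf kl) !andbF /= => kiG ikG.
by have := chain _ _ _ ik ilG klG; rewrite kiG ikG.
Qed.

End ForestOrder.

(** Both points are iterates of [f] at [x]; the one needing fewer steps reaches the other. *)
Lemma fconnect_total (T : finType) (f : T -> T) x y z :
  fconnect f x y -> fconnect f x z -> fconnect f y z || fconnect f z y.
Proof.
move=> /iter_findex <- /iter_findex <-.
have [le_m|/ltnW le_m] := leqP (findex f x y) (findex f x z);
  by rewrite -(subnK le_m) iterD fconnect_iter ?orbT.
Qed.

(** * Ancestor orders of parent maps *)

Section Ancestors.
Variables (V W : finType) (r : V) (h : W -> V).
Hypotheses (h_inj : injective h) (h_neq : forall w, h w != r).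
Hypothesis h_surj : forall v, v != r -> exists w, v = h w.
Implicit Types (p q : {ffun V -> V}).

(** The orbit starts at the parent, which makes ancestry proper. Since [h] names the vertices other
    than [r], the root is left out of the order. *)
Definition ancestors p : {set W * W} :=
  [set ik | fconnect p (p (h ik.2)) (h ik.1)]%SET.

(** The ancestors of a vertex lie on a single orbit, where [fconnect_total] makes any two
    comparable. *)
Lemma ancestors_forest p : parent_map r p -> forest_order (ancestors p).
Proof.
move=> pP; split.
- move=> i; rewrite /edge_rel inE /=; apply/negP => /(parent_connect pP (h_neq i)).
  by rewrite connect0.
- move=> j i k; rewrite /edge_rel !inE /= => ij jk.
  exact: connect_trans jk (connect_trans (fconnect1 _ _) ij).
- move=> i k l ik; rewrite !inE /= => li lk.
  have := fconnect_total li lk.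
  rewrite [fconnect _ (h i) _]fconnect_eqVf [fconnect _ (h k) _]fconnect_eqVf.
  by rewrite !(inj_eq h_inj) eq_sym [_ == i]eq_sym (negPf ik) /= orbC.
Qed.

(** If the two parents of [k] were distinct vertices [h i] and [h j], then [i] and [j] would be
    proper ancestors of each other. *)
Lemma ancestors_inj p q :
  parent_map r p -> parent_map r q -> ancestors p = ancestors q -> p = q.
Proof.
have sub p' q' i k : ancestors p' = ancestors q' ->
    p' (h k) = h i -> fconnect q' (q' (h k)) (h i).
  move=> E pk; have : (i, k) \in ancestors p' by rewrite inE /= pk connect0.
  by rewrite E inE.
(* A parent equal to the root means having no predecessors, which the order detects. *)
have sub0 p' q' k : parent_map r p' -> ancestors p' = ancestors q' ->
    p' (h k) = r -> q' (h k) = r.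
  move=> pP E pk; apply/eqP/negPn/negP => /h_surj[j qk].
  have := sub q' p' j k (esym E) qk; rewrite pk => /iter_findex.
  by rewrite iter_fix ?pP.1 // => rj; have := h_neq j; rewrite -rj eqxx.
move=> pP qP E; apply/ffunP => v.
have [->|/h_surj[k ->]] := eqVneq v r; first by rewrite pP.1 qP.1.
have [pk|/h_surj[i pk]] := eqVneq (p (h k)) r.
  by rewrite pk (sub0 p q).
have [qk|/h_surj[j qk]] := eqVneq (q (h k)) r.
  by rewrite qk (sub0 q p).
have pij := sub _ _ _ _ (esym E) qk; have qji := sub _ _ _ _ E pk.
rewrite pk qk in pij qji *; apply/eqP/negPn/negP => ij.
have Gij : (i, j) \in ancestors q.
  by move: qji; rewrite fconnect_eqVf eq_sym (negPf ij) inE.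
have Gji : (j, i) \in ancestors q.
  by move: pij; rewrite fconnect_eqVf (negPf ij) -E inE.
have [irr tr _] := ancestors_forest qP.
by have := tr _ _ _ Gij Gji; rewrite irr.
Qed.

(** The rank, counting predecessors, grows along edges. Hence a predecessor of maximal rank comes
    after all the others by the chain condition, and induction on rank applies along parents. *)
Lemma ancestors_surj (G : {set W * W}) : forest_order G ->
  exists2 p, parent_map r p & ancestors p = G.
Proof.
move=> [irr tr chain].
pose rank k := #|[set i | (i, k) \in G]%SET|.
have rank_lt i k : (i, k) \in G -> (rank i < rank k)%N.
  move=> ik; apply: proper_card; apply/properP; split.
    by apply/fintype.subsetP => j; rewrite !inE => ji; apply: tr ji ik.
  by exists i; rewrite inE // [_ \in G]irr.
(* The parent of [k] is the largest predecessor of [k], or the root. *)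
have step v : exists u, (v = r -> u = r) /\ forall k, v = h k ->
    forall j, (j, k) \in G <-> (u = h j \/ exists2 i, u = h i & (j, i) \in G).
  have [->|vr] := eqVneq v r.
    by exists r; split=> // k rk; have := h_neq k; rewrite -rk eqxx.
  have [k vk] := h_surj vr.
  have [i0 i0k|none] := pickP [pred i | (i, k) \in G].
    case: (arg_maxnP rank i0k) => i /= ik max_i.
    exists (h i); split=> [vr0|_ /[!vk]/h_inj <- j].
      by rewrite vr0 eqxx in vr.
    split=> [jk|[/h_inj <-//|[_ /h_inj <- ji]]]; last exact: tr ji ik.
    have [->|ij] := eqVneq i j; [by left|right; exists i => //].
    have /orP[/rank_lt|//] := chain _ _ _ ij ik jk.
    by rewrite ltnNge max_i.
  exists r; split=> // _ /[!vk]/h_inj <- j; split=> [jk|[rj|[i ri]]].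
  - by have := none j; rewrite /= jk.
  - by have := h_neq j; rewrite -rj eqxx.
  - by have := h_neq i; rewrite -ri eqxx.
have [f fP] := fin_all_exists step.
pose p := finfun f.
have pr : p r = r by rewrite ffunE; apply: (fP r).1.
(* The predecessors of [k] are its parent and those of its parent; by induction on rank this
   recursion determines the order. *)
have pE k j : (j, k) \in G <->
    (p (h k) = h j \/ exists2 i, p (h k) = h i & (j, i) \in G).
  by rewrite ffunE; apply: (fP (h k)).2.
exists p.
  split=> // v; have [->|/h_surj[k ->]] := eqVneq v r; first exact: connect0.
  have [m] := ubnP (rank k); elim: m k => // m IHm k lt_k.
  apply: connect_trans (fconnect1 _ _) _.
  have [->|/h_surj[i pk]] := eqVneq (p (h k)) r; first exact: connect0.
  rewrite pk; apply: IHm; rewrite -ltnS; apply: leq_trans lt_k; rewrite ltnS.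
  by apply: rank_lt; apply/pE; left.
apply/finset.setP => -[j k]; rewrite inE /=.
have [m] := ubnP (rank k); elim: m k => // m IHm k lt_k.
have [pk|/h_surj[i pk]] := eqVneq (p (h k)) r.
  rewrite pk; apply/idP/idP.
    move=> /iter_findex; rewrite iter_fix // => rj.
    by have := h_neq j; rewrite -rj eqxx.
  by case/pE => [rj|[i ri]]; [have := h_neq j|have := h_neq i];
    rewrite -?rj -?ri pk eqxx.
rewrite pk fconnect_eqVf (inj_eq h_inj) IHm; last first.
  by rewrite -ltnS; apply: leq_trans lt_k; rewrite ltnS; apply: rank_lt; apply/pE; left.
apply/orP/idP => [[/eqP<-|ji]|/pE].
- by apply/pE; left.
- by apply/pE; right; exists i.
- by rewrite pk => -[/h_inj->|[_ /h_inj<-]]; [left|right].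
Qed.

End Ancestors.

(** * Matrices of linear operators on [F^n] *)

Section Coefficients.
Variables (F : fieldType) (n : nat).
Local Notation A := {ffun 'I_n -> F^o}.
Implicit Types (R : 'End(A)) (x y : A) (m : 'I_n -> 'I_n -> F) (i j k : 'I_n).

Fact regular_scaleE (a : F) (b : F^o) : a *: b = a * b :> F.
Proof. by []. Qed.

Definition idempotent_basis i : A := [ffun k => (k == i)%:R].

Definition coef R i k : F := R (idempotent_basis i) k.

Lemma lfun_coefE R x k : R x k = \sum_i x i * coef R i k.
Proof.
have {1}-> : x = \sum_i x i *: idempotent_basis i.
  apply/ffunP => j; rewrite sum_ffunE (bigD1 j) //= big1 => [|i ij].
    by rewrite !ffunE eqxx regular_scaleE mulr1 addr0.
  by rewrite !ffunE eq_sym (negPf ij) scaler0.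
by rewrite linear_sum sum_ffunE; apply: eq_bigr => i _; rewrite linearZ ffunE.
Qed.

Lemma coef_inj R R' : coef R =2 coef R' -> R = R'.
Proof.
move=> E; apply/lfunP => x; apply/ffunP => k; rewrite !lfun_coefE.
by apply: eq_bigr => i _; rewrite E.
Qed.

Definition apply_coef m x : A := [ffun k => \sum_i x i * m i k].

Fact apply_coef_linear m : linear (apply_coef m).
Proof.
move=> a x y; apply/ffunP => k; rewrite !ffunE scaler_sumr -big_split /=.
by apply: eq_bigr => i _; rewrite !ffunE mulrDl -mulrA.
Qed.

HB.instance Definition _ m :=
  GRing.isLinear.Build F A A *:%R (apply_coef m) (apply_coef_linear m).

Lemma coef_surj m : exists R, coef R =2 m.
Proof.
exists (linfun (apply_coef m)) => i k; rewrite /coef lfunE /= ffunE.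
rewrite (bigD1 i) //= big1 => [|j ji]; first by rewrite ffunE eqxx mul1r addr0.
by rewrite ffunE (negPf ji) mul0r.
Qed.

(** The Rota-Baxter identity for [e_i] and [e_j], read at coordinate [k]. *)
Definition rota_baxter_coef (lambda : F) m : Prop := forall i j k,
  m i k * m j k = m i j * m j k + m j i * m i k + lambda * ((i == j)%:R * m i k).

(** Both sides of the identity are bilinear in [x] and [y], so basis vectors suffice. *)
Lemma rota_baxter_coefP (lambda : F) R :
  rota_baxter lambda R <-> rota_baxter_coef lambda (coef R).
Proof.
split=> [RB i j k | RB x y].
  have := congr1 (fun z : A => z k)
    (RB (idempotent_basis i) (idempotent_basis j)).
  rewrite ffunE => ->; rewrite lfun_coefE.
  under eq_bigr => l _ do rewrite !ffunE !mulrDl.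
  rewrite !big_split /=; congr (_ + _ + _).
  - rewrite (bigD1 j) //= big1 => [|l lj]; first by rewrite eqxx mulr1 addr0.
    by rewrite (negPf lj) mulr0 mul0r.
  - rewrite (bigD1 i) //= big1 => [|l li]; first by rewrite eqxx mul1r addr0.
    by rewrite (negPf li) !mul0r.
  - rewrite (bigD1 i) //= big1 => [|l li]; first by rewrite eqxx mul1r addr0 -mulrA.
    by rewrite (negPf li) mul0r scaler0 mul0r.
apply/ffunP => k; rewrite ffunE !lfun_coefE mulr_suml.
under eq_bigr => i _ do rewrite mulr_sumr.
under [RHS]eq_bigr => l _ do rewrite !ffunE !mulrDl !lfun_coefE.
rewrite !big_split /=.
under eq_bigr => i _ do under eq_bigr => j _ do
  rewrite mulrACA RB !mulrDr.
under eq_bigr => i _ do rewrite !big_split.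
rewrite !big_split /=; congr (_ + _ + _).
- rewrite exchange_big; apply: eq_bigr => j _ /=; rewrite !mulr_suml.
  by apply: eq_bigr => i _; ring.
- apply: eq_bigr => i _; rewrite mulr_sumr mulr_suml.
  by apply: eq_bigr => j _; ring.
- apply: eq_bigr => i _; rewrite (bigD1 i) //= big1 => [|j ji].
    by rewrite eqxx mul1r addr0 -[RHS]mulrA; ring.
  by rewrite eq_sym (negPf ji) mul0r !mulr0.
Qed.

End Coefficients.

(** * Rota-Baxter matrices as colored forest orders *)

Section Classification.
Variables (F : fieldType) (n : nat) (lambda : F).
Hypothesis lambda_neq0 : lambda != 0.
Implicit Types (m : 'I_n -> 'I_n -> F) (G : {set 'I_n * 'I_n}).

(* In characteristic 2 the signs of the off-diagonal entries do not determine
   the colors, but the vanishing of the diagonal entries still does. *)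
Definition colored_digraph_of m : {set 'I_n * 'I_n} * {ffun 'I_n -> bool} :=
  ([set ik | (ik.1 != ik.2) && (m ik.1 ik.2 != 0)]%SET,
   [ffun i => m i i != 0]).

(** Here [s] is [2 r_ii + lambda], the common value of the nonzero off-diagonal entries of row
    [i]. *)
Definition coef_of (Gc : {set 'I_n * 'I_n} * {ffun 'I_n -> bool}) i k : F :=
  let s := if Gc.2 i then - lambda else lambda in
  if i == k then (if Gc.2 i then - lambda else 0)
  else if (i, k) \in Gc.1 then s else 0.

Lemma coef_ofK m :
  rota_baxter_coef lambda m -> coef_of (colored_digraph_of m) =2 m.
Proof.
move=> RB i k; rewrite /coef_of /= ffunE inE /=.
(* The instance [i = j = k] reads [m j j ^ 2 = 2 m j j ^ 2 + lambda m j j]. *)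
have diag j : m j j != 0 -> m j j = - lambda.
  move=> mj; have := RB j j j; rewrite eqxx mul1r => E.
  apply: (mulIf mj); apply: (addrI (m j j * m j j + lambda * m j j)).
  by transitivity (m j j * m j j); [rewrite [RHS]E|]; ring.
(* The instance [j = i] reads [m i k ^ 2 = (2 m i i + lambda) m i k]. *)
have sq : m i k != 0 -> m i k = m i i + m i i + lambda.
  move=> mk; have := RB i i k; rewrite eqxx mul1r => E.
  by apply: (mulIf mk); rewrite E; ring.
have [<-|ik] := eqVneq i k.
  by have [->|/diag->] := eqVneq (m i i) 0.
have [->//|/sq->] := eqVneq (m i k) 0.
have [->|/diag->] := eqVneq (m i i) 0; rewrite ?add0r //=; by ring.
Qed.

Lemma colored_digraph_ofK Gc : simple_digraph Gc.1 ->
  colored_digraph_of (coef_of Gc) = Gc.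
Proof.
case: Gc => G c /= simG; rewrite /colored_digraph_of /coef_of /=.
congr pair; last first.
  by apply/ffunP => i; rewrite ffunE eqxx; case: (c i); rewrite ?oppr_eq0 ?eqxx.
apply/finset.setP => -[i k]; rewrite inE /=.
have [<-|ik] /= := eqVneq i k; first by rewrite (negPf (simG i)).
by case: ifP => _; rewrite ?eqxx //; case: (c i); rewrite ?oppr_eq0.
Qed.

Lemma rota_baxter_forest m : rota_baxter_coef lambda m ->
  forest_order (colored_digraph_of m).1.
Proof.
move=> RB.
(* In the instance [k = i] the terms [m i i * m j i] cancel. *)
have anti i j : i != j -> m i j * m j i = 0.
  move=> ij; have := RB i j i; rewrite (negPf ij) mul0r mulr0 addr0 => /eqP.
  by rewrite [m j i * m i i]mulrC -subr_eq subrr eq_sym => /eqP.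
split.
- by move=> i; rewrite /edge_rel inE /= eqxx.
- move=> j i k; rewrite /edge_rel !inE /= => /andP[ij mij] /andP[jk mjk].
  have mji : m j i = 0.
    by have /eqP := anti i j ij; rewrite mulf_eq0 (negPf mij) => /eqP.
  apply/andP; split; first by apply: contraNneq mjk => <-; rewrite mji.
  (* If [m i k] vanished, the instance [(i, j, k)] would reduce to [0 = m i j * m j k]. *)
  apply: contraNneq (mulf_neq0 mij mjk) => mik.
  have := RB i j k; rewrite (negPf ij) mik mji !mul0r !mulr0 !addr0.
  by move=> <-.
- move=> i k l ik; rewrite !inE /= => /andP[il mil] /andP[kl mkl].
  rewrite ik [k == i]eq_sym ik -negb_and; apply/negP => /andP[/eqP mik /eqP mki].
  (* With [i] and [k] unrelated the right side vanishes, while [m i l * m k l] does not. *)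
  have /eqP := RB i k l; rewrite (negPf ik) mik mki !mul0r mulr0 !addr0.
  by rewrite mulf_eq0 (negPf mil) (negPf mkl).
Qed.

(** For distinct indices, an edge between [i] and [j] makes both sides the same product of row
    values or both zero, by transitivity. Without such an edge the right side is zero, and so is the
    left by the chain condition. *)
Lemma forest_rota_baxter Gc : forest_order Gc.1 ->
  rota_baxter_coef lambda (coef_of Gc).
Proof.
case: Gc => G c [irr tr chain] /= i j k; rewrite /coef_of /=.
have asym a b : (a, b) \in G -> (b, a) \in G = false.
  by move=> ab; apply/negP => ba; have := tr _ _ _ ab ba; rewrite irr.
have [<-|ij] := eqVneq i j; rewrite ?(mul0r, mulr0, mul1r, addr0).
  by case: eqP => _; case: (c i); try case: ifP => _; ring.
(* When [k] is [i] or [j], asymmetry kills the product of the two opposite entries and the other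
   terms cancel. *)
have [<-|ik] := eqVneq i k.
  rewrite [j == i]eq_sym (negPf ij).
  case: (boolP ((i, j) \in G)) => [/asym->|_]; by ring.
have [<-|jk] := eqVneq j k.
  case: (boolP ((i, j) \in G)) => [/asym->|_]; by ring.
have [Gij|nGij] := boolP ((i, j) \in G).
  rewrite (asym _ _ Gij); have [Gjk|_] := boolP ((j, k) \in G); last by ring.
  by have -> : (i, k) \in G := tr _ _ _ Gij Gjk; ring.
have [Gji|nGji] := boolP ((j, i) \in G).
  have [Gik|_] := boolP ((i, k) \in G); last by ring.
  by have -> : (j, k) \in G := tr _ _ _ Gji Gik; ring.
have [Gik|_] := boolP ((i, k) \in G); last by ring.
have [Gjk|_] := boolP ((j, k) \in G); last by ring.
by have := chain _ _ _ ij Gik Gjk; rewrite (negPf nGij) (negPf nGji).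
Qed.

Lemma rota_baxter_bij :
  set_bij [set R | rota_baxter lambda R]
          (colored_transitive_subtree_acyclic 'I_n)
          (colored_digraph_of \o @coef F n).
Proof.
split.
- by move=> R /= /rota_baxter_coefP/rota_baxter_forest/forest_orderP.
- move=> R R'; rewrite !inE /= => /rota_baxter_coefP RB /rota_baxter_coefP RB' E.
  by apply: coef_inj => i k; rewrite -coef_ofK // E coef_ofK.
- move=> Gc /= GcP; have [R RE] := coef_surj (coef_of Gc).
  have E : coef R = coef_of Gc by apply/boolp.funext => i; apply/boolp.funext => k; apply: RE.
  exists R; last by rewrite /= E colored_digraph_ofK //; case: GcP.1.
  by apply/rota_baxter_coefP; rewrite E; apply/forest_rota_baxter/forest_orderP.
Qed.

End Classification.

(** * Transport of orders and colors to the non-root vertices *)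

Section ColoredAncestors.
Variables (V W : finType) (r : V) (phi : W -> {v : V | v != r}).
Hypothesis phi_bij : bijective phi.

Lemma ancestors_bij :
  set_bij [set pc : {ffun V -> V} * {ffun {v : V | v != r} -> bool} |
            parent_map r pc.1]
          (colored_transitive_subtree_acyclic W)
          (fun pc => (ancestors (fun w => val (phi w)) pc.1,
                      [ffun w => pc.2 (phi w)])).
Proof.
have h_inj : injective (fun w => val (phi w)).
  exact: inj_comp val_inj (bij_inj phi_bij).
have h_neq w : val (phi w) != r := valP (phi w).
have [psi phiK psiK] := phi_bij.
have h_surj v : v != r -> exists w, v = val (phi w).
  by move=> vr; exists (psi (Sub v vr)); rewrite psiK.
split.
- by move=> [p c] /= /(ancestors_forest h_inj h_neq)/forest_orderP.
- move=> [p c] [q d]; rewrite !inE /= => pP qP [Epq /ffunP Ecd].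
  rewrite (ancestors_inj h_inj h_neq h_surj pP qP Epq); congr (_, _).
  by apply/ffunP => v; have := Ecd (psi v); rewrite !ffunE psiK.
- move=> [G c] /= /forest_orderP/(ancestors_surj h_inj h_neq h_surj)[p pP Ep].
  exists (p, [ffun v => c (psi v)]) => //=; rewrite Ep; congr (_, _).
  by apply/ffunP => w; rewrite !ffunE phiK.
Qed.

End ColoredAncestors.

Theorem corollary2 (F : fieldType) (n : nat) (hn : (1 <= n)%N)
    (lambda : F) (hlambda : lambda <> 0) :
  (exists f : 'End({ffun 'I_n -> F^o}) ->
              {set 'I_n * 'I_n} * {ffun 'I_n -> bool},
     set_bij [set R | rota_baxter lambda R]
             (colored_transitive_subtree_acyclic 'I_n) f) /\
  (exists g : 'End({ffun 'I_n -> F^o}) ->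
              {set {set 'I_n.+1}} * {ffun {v : 'I_n.+1 | v != ord0} -> bool},
     set_bij [set R | rota_baxter lambda R]
             (rooted_trees_colored 'I_n.+1 ord0) g).
Proof.
have lambda_neq0 : lambda != 0 by apply/eqP.
have bij_a := rota_baxter_bij n lambda_neq0.
split; first by eexists; exact: bij_a.
(* Vertex [i] of the digraph becomes vertex [i + 1] of the tree, the root being 0. *)
pose phi (i : 'I_n) : {v : 'I_n.+1 | v != ord0} :=
  Sub (lift ord0 i) (neq_lift ord0 i).
have phi_bij : bijective phi.
  apply: inj_card_bij; last by rewrite card_sub card_ord cardC1 card_ord.
  by move=> i j /(congr1 val) /= /lift_inj.
(* A value for the partial inverse outside the image, where any choice serves. *)
pose dflt (Gc : {set 'I_n * 'I_n} * {ffun 'I_n -> bool}) :=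
  ([ffun=> ord0], [ffun=> false]) :
    {ffun 'I_n.+1 -> 'I_n.+1} * {ffun {v : 'I_n.+1 | v != ord0} -> bool}.
have bij_inv := bijpinv_bij dflt (ancestors_bij phi_bij).
(* An operator goes to its colored order, then to the parent map with these ancestors, then to the
   tree of that map. *)
eexists; exact: set_bij_comp bij_a (set_bij_comp bij_inv (@tree_of_bij _ _ _)).
Qed.
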